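(* Let $T$ be a tessellation of $\mathbb{R}^k$, let $0<\lambda<1$, and let $T^{1}=\lambda T$ be its smaller-scale copy. If $\chi(T)$ is refinable, i.e. if the indicator function of every cell of $T$ is a linear combination of indicator functions of cells of $T^{1}$, then every facet of $T$ is a union of facets of $T^{1}$.
   Context: A tessellation $T$ of $\mathbb{R}^k$ is a locally finite family of full-dimensional convex polytopes (the cells) that cover $\mathbb{R}^k$ and have pairwise disjoint interiors. A facet of $T$ is a $(k-1)$-dimensional face of a cell of $T$. For $\lambda>0$, $\lambda T=\{\lambda c : c\in T\}$. $\chi(T)$ denotes the space of indicator functions of the cells of $T$ (each function is $1$ on its cell and $0$ elsewhere). Linear combinations may be infinite (the sums are locally finite), and equality of functions is understood almost everywhere (values on cell boundaries are disregarded). *)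

(* Defs.v *)
From HB Require Import structures.
From mathcomp Require Import all_boot all_order all_algebra.
From mathcomp Require Import all_classical all_reals all_analysis.
Import Order.TTheory GRing.Theory Num.Theory.
Import numFieldNormedType.Exports.

Set Implicit Arguments.
Unset Strict Implicit.
Unset Printing Implicit Defensive.

Local Open Scope classical_set_scope.
Local Open Scope ring_scope.

Section Tessellations.
Variables (R : realType) (k : nat).
Implicit Types (A N P F C D : set 'rV[R]_k) (T : set (set 'rV[R]_k)).

Definition polytope P : Prop :=
  exists2 A : set 'rV[R]_k, finite_set A & P = smallest (@convex_set R 'rV[R]_k) A.

Definition spans_differences A (V : {vspace 'rV[R]_k}) : Prop :=
  forall x y, A x -> A y -> x - y \in V.

(* [V] is the direction of the affine hull of [A]; the empty set has no
   dimension here. *)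
Definition has_dim A (d : nat) : Prop :=
  A !=set0 /\ exists V : {vspace 'rV[R]_k},
    [/\ spans_differences A V,
        forall W : {vspace 'rV[R]_k}, spans_differences A W -> (V <= W)%VS &
        \dim V = d].

(* Faces are cut out by valid linear inequalities; [P] is a face of itself
   (take [u = 0] and [b = 0]). *)
Definition face P F : Prop :=
  exists (u : 'cV[R]_k) (b : R),
    (forall x, P x -> (x *m u) 0 0 <= b) /\
    F = P `&` [set x | (x *m u) 0 0 = b].

Definition locally_finite T : Prop :=
  forall x : 'rV[R]_k,
    exists2 U, nbhs x U & finite_set [set C | T C /\ C `&` U !=set0].

Definition tessellation T : Prop :=
  [/\ locally_finite T,
      forall C, T C -> polytope C /\ has_dim C k,
      \bigcup_(C in T) C = setT &
      forall C D, T C -> T D -> C <> D -> C° `&` D° = set0].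

(* The dimension [k - 1] is written [d] with [d.+1 = k], so as not to truncate
   the subtraction when [k = 0]. *)
Definition facet T F : Prop :=
  exists2 C, T C & face C F /\ exists2 d, d.+1 = k & has_dim F d.

Definition scale_family (lambda : R) T : set (set 'rV[R]_k) :=
  [set [set lambda *: x | x in C] | C in T].

Definition open_box (a b : 'rV[R]_k) : set 'rV[R]_k :=
  [set x | forall i, a 0 i < x 0 i < b 0 i].

Definition box_volume (a b : 'rV[R]_k) : R := \prod_i (b 0 i - a 0 i).

(* Lebesgue-null sets of R^k. *)
Definition lebesgue_null N : Prop :=
  forall e : R, 0 < e -> exists a b : nat -> 'rV[R]_k,
    [/\ forall n i, a n 0 i <= b n 0 i,
        N `<=` \bigcup_n open_box (a n) (b n) &
        (\sum_(0 <= n <oo) (box_volume (a n) (b n))%:E <= e%:E)%E].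

Definition eq_ae (f g : 'rV[R]_k -> R) : Prop :=
  lebesgue_null [set x | f x <> g x].

(* Over a locally finite [S] the finitely supported sum has, at each [x], only
   finitely many nonzero terms, hence is the actual pointwise sum. *)
Definition indicator_combination (S : set (set 'rV[R]_k))
    (c : set 'rV[R]_k -> R) : 'rV[R]_k -> R :=
  fun x => \sum_(D \in S) c D * \1_D x.

Definition refinable (lambda : R) T : Prop :=
  forall C, T C -> exists c : set 'rV[R]_k -> R,
    eq_ae (\1_C) (indicator_combination (scale_family lambda T) c).

End Tessellations.

(* Main.v *)
(* A cell D of lambda T whose interior meets the interior of a cell C of T lies
   in C: the combination giving the indicator function of C is constant on the
   interior of D, hence equal to 1 there.  So C is the union of the cells of
   lambda T it contains, and a facet F of C is the union of their faces D `&` F.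
   The faces of smaller dimension are redundant.  Near x in F only finitely many
   of them matter; for each one pick a point of F outside x + W, where W is the
   direction of its affine hull, and run through these points a polynomial curve
   t |-> y t in F starting at x.  Modulo W, y is a non-constant polynomial, so
   each small face contains y t for finitely many t only, and points of F
   arbitrarily close to x lie in full-dimensional faces, which are closed. *)
Require Import Defs.
From HB Require Import structures.
From mathcomp Require Import all_boot all_order all_algebra.
From mathcomp Require Import all_classical all_reals all_analysis.
From mathcomp Require Import measurable_realfun ring lra.
Import Order.TTheory GRing.Theory Num.Theory.
Import numFieldNormedType.Exports.
Local Open Scope classical_set_scope.
Local Open Scope ring_scope.
Set Implicit Arguments.
Unset Strict Implicit.
Unset Printing Implicit Defensive.

(** * Nonempty open sets are not Lebesgue-null *)

(* The weights make the induction on k go through: fixing the first coordinate t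
   multiplies the n-th weight by the indicator at t of the n-th first side, and
   integrating over t turns this factor back into a length. *)
Lemma weighted_box_cover (R : realType) (k : nat) (p q : 'I_k -> R)
    (a b : nat -> 'I_k -> R) (w : nat -> R) :
  (forall i, p i <= q i) -> (forall n i, a n i <= b n i) ->
  (forall n, 0 <= w n) ->
  (forall x : 'I_k -> R, (forall i, p i <= x i <= q i) ->
    (1%:E <= \sum_(0 <= n <oo)
      (w n * \prod_i \1_(`]a n i, b n i[%classic : set R) (x i))%:E)%E) ->
  ((\prod_i (q i - p i))%:E <=
    \sum_(0 <= n <oo) (w n * \prod_i (b n i - a n i))%:E)%E.
Proof.
elim: k => [|k IH] in p q a b w *; move=> pq ab w0 cover.
  have := cover (fun=> 0) (fun i => match i with Ordinal m lt => ltac:(by []) end).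
  rewrite big_ord0; congr (_ <= _)%E.
  by apply: eq_eseriesr => n _; rewrite !big_ord0.
pose V := \prod_(i < k) (q (lift ord0 i) - p (lift ord0 i)).
pose D : set R := `[p ord0, q ord0]%classic.
pose J n : set R := `]a n ord0, b n ord0[%classic.
have mD : measurable D by exact: measurable_itv.
have mJ n : measurable (J n) by exact: measurable_itv.
pose v n := w n * \prod_(i < k) (b n (lift ord0 i) - a n (lift ord0 i)).
have v0 n : 0 <= v n.
  by rewrite mulr_ge0// prodr_ge0// => i _; rewrite subr_ge0.
have slice t : t \in `[p ord0, q ord0] ->
    (V%:E <= \sum_(0 <= n <oo) ((v n)%:E * (\1_(J n) t)%:E))%E.
  move=> tpq.
  have := IH (fun i => p (lift ord0 i)) (fun i => q (lift ord0 i))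
    (fun n i => a n (lift ord0 i)) (fun n i => b n (lift ord0 i))
    (fun n => w n * \1_(J n) t)
    (fun i => pq _) (fun n i => ab _ _).
  have w'0 n : 0 <= w n * \1_(J n) t.
    by rewrite mulr_ge0.
  move=> /(_ w'0) H.
  rewrite (eq_eseriesr (g := fun n => (w n * \1_(J n) t *
     \prod_(i < k) (b n (lift ord0 i) - a n (lift ord0 i)))%:E)); last first.
    by move=> n _; rewrite -EFinM mulrAC.
  apply: H => x xpq.
  pose y i := if unlift ord0 i is Some j then x j else t.
  have := cover y.
  rewrite (eq_eseriesr (g := fun n => (w n * \1_(J n) t *
    \prod_(i < k) \1_(`]a n (lift ord0 i), b n (lift ord0 i)[%classic : set R) (x i))%:E)); last first.
    move=> n _; rewrite big_ord_recl /y unlift_none mulrA; congr (_ * _)%:E.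
    by apply: eq_bigr => i _; rewrite liftK.
  apply=> i; rewrite /y; case: unliftP => [j ->//|->].
  by move: tpq; rewrite in_itv.
rewrite big_ord_recl -/V.
pose f n (t : R) : \bar R := ((v n)%:E * (\1_(J n) t)%:E)%E.
have mI n : measurable_fun D
    ((fun t => (\1_(J n) t)%:E) : R -> \bar R).
  by apply/measurable_EFinP/measurable_indic.
have mf n : measurable_fun D (f n).
  exact: measurable_funeM.
have f0 n (t : R) : (0 <= f n t)%E by rewrite /f -EFinM lee_fin mulr_ge0.
(* Integrate [slice] over [t] in [D]: the left side is the integral of the constant [V], and on the
   right sum and integral are exchanged. *)
have -> : ((q ord0 - p ord0) * V)%:E =
    (\int[lebesgue_measure]_(t in D) cst V%:E t)%E.
  rewrite integral_cst//= lebesgue_measure_itv/= lte_fin.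
  have [//|qp] := ltP (p ord0) (q ord0); first by rewrite -EFinM mulrC.
  by rewrite mule0 (@le_anti _ _ (q ord0) (p ord0)) ?qp ?pq// subrr mul0r.
apply: (@le_trans _ _ (\sum_(0 <= n <oo) \int[lebesgue_measure]_(t in D) f n t)%E).
  rewrite -integral_nneseries//.
  apply: ge0_le_integral => //.
  - by move=> t _; rewrite lee_fin prodr_ge0// => i _; rewrite subr_ge0.
  - rewrite [X in measurable_fun _ X](_ : _ =
      (fun t : R => \sum_(n <oo | n \in predT) f n t)%E); last first.
      by apply/funext => t; apply: eq_eseriesl.
    exact: (@ge0_emeasurable_sum _ _ R D _ predT).
apply: lee_nneseries => [n _ _|n _].
  by apply: integral_ge0 => t _; apply: f0.
rewrite /f ge0_integralZl_EFin//; last exact: mI.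
rewrite integral_indic//=; last exact: mJ.
rewrite big_ord_recl.
rewrite [X in (_ <= X)%E](_ : _ = (v n)%:E * (b n ord0 - a n ord0)%:E)%E; last first.
  by rewrite -EFinM /v; congr EFin; ring.
apply: lee_wpmul2l; first by rewrite lee_fin.
apply: (@le_trans _ _ (lebesgue_measure (J n))).
  apply: le_measure; rewrite ?inE; [|exact: mJ|by []].
  by apply: measurableI; [exact: mJ|exact: mD].
rewrite /J lebesgue_measure_itv/= lte_fin; case: ifP => //= _.
by rewrite lee_fin subr_ge0.
Qed.

(** An interior point would be the center of a closed cube of side [r] inside [N]. The previous
    inequality, with all weights 1, forbids covering this cube by boxes of half its volume in
    total. *)
Lemma interior_lebesgue_null (R : realType) (k : nat) (N : set 'rV[R]_k) :
  lebesgue_null N -> N° = set0.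
Proof.
move=> nullN; apply/seteqP; split=> // x /nbhs_ballP[r r0 rN] /=.
have s0 : 0 < r / 2 by rewrite divr_gt0.
pose p i := x 0 i - r / 2; pose q i := x 0 i + r / 2.
have V0 : 0 < \prod_i (q i - p i).
  by apply: prodr_gt0 => i _; rewrite /p /q; lra.
have [|a [b [ab Ncov le_e]]] := nullN (\prod_i (q i - p i) / 2).
  by rewrite divr_gt0.
suff : ((\prod_i (q i - p i))%:E <= (\prod_i (q i - p i) / 2)%:E)%E.
  by rewrite lee_fin; lra.
apply: le_trans le_e.
have := @weighted_box_cover R k p q (fun n i => a n 0 i) (fun n i => b n 0 i)
  (fun=> 1).
rewrite (eq_eseriesr (g := fun n => (box_volume (a n) (b n))%:E)); last first.
  by move=> n _; rewrite mul1r.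
apply=> // [i|y ypq]; first by rewrite /p /q; lra.
have : N (\row_i y i).
  apply: rN; rewrite -ball_normE /=.
  rewrite [ltLHS]mx_normrE; apply: (le_lt_trans (y := r / 2)); last by lra.
  apply/bigmax_leP; split=> [|[i j] _ /=]; first exact: ltW.
  rewrite !mxE ord1 ler_norml.
  by have := ypq j; rewrite /p /q; lra.
move=> /Ncov[n _ yn].
apply: (@le_trans _ _ (1 * \prod_i \1_(`]a n 0 i, b n 0 i[%classic : set R) (y i))%:E).
  rewrite mul1r big1// => i _; rewrite indicE mem_set//= in_itv/=.
  by have := yn i; rewrite mxE.
pose u m : \bar R := (1 * \prod_i \1_(`]a m 0 i, b m 0 i[%classic : set R) (y i))%:E.
have u0 m : (0 <= u m)%E by rewrite lee_fin mul1r prodr_ge0.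
apply: le_trans (nneseries_lim_ge n.+1 (fun m _ _ => u0 m)).
by rewrite big_nat_recr//= leeDr// sume_ge0.
Qed.

(** * Convex sets and polytopes *)

Section Convexity.
Context {R : realType} {V : lmodType R}.
Implicit Types (A : set V) (x y : V).

Lemma convex_setE A : @convex_set R V A <->
  forall x y (t : R), 0 <= t -> t <= 1 -> A x -> A y ->
    A (t *: x + (1 - t) *: y).
Proof.
split=> [cA x y t t0 t1 /mem_set Ax /mem_set Ay|cA x y t].
  exact/set_mem/(cA _ _ (Itv01 t0 t1) Ax Ay).
by rewrite !inE => Ax Ay; apply: cA.
Qed.

(** Dividing by the total weight, instead of assuming it to be 1, lets the induction drop a point.
    If the remaining weights sum to 0 they all vanish; otherwise the first point is combined with
    the barycenter of the rest. *)
Lemma convex_set_sum A n (w : 'I_n -> R) (p : 'I_n -> V) :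
  @convex_set R V A -> (forall i, A (p i)) -> (forall i, 0 <= w i) ->
  0 < \sum_i w i -> A ((\sum_i w i)^-1 *: \sum_i w i *: p i).
Proof.
move=> /convex_setE cA; elim: n => [|n IH] in w p *; move=> Ap w0.
  by rewrite big_ord0 ltxx.
rewrite !big_ord_recl; set s := \sum_(i < n) _; set u := \sum_(i < n) _.
have s0 : 0 <= s by apply: sumr_ge0.
have [sE|sn0 sw0] := eqVneq s 0.
  have -> : u = 0.
    apply: big1 => i _.
    have /psumr_eq0P : s = 0 by [].
    by move=> /(_ (fun i _ => w0 _) i isT) ->; rewrite scale0r.
  by rewrite sE !addr0 => wpos; rewrite scalerA mulVf ?gt_eqF// scale1r.
have spos : 0 < s by rewrite lt_neqAle eq_sym sn0.
have := IH (fun i => w (lift ord0 i)) (fun i => p (lift ord0 i))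
  (fun i => Ap _) (fun i => w0 _) spos.
rewrite -/s -/u => Au.
have wu : 0 < w ord0 + s by rewrite ltr_wpDl.
have -> : (w ord0 + s)^-1 *: (w ord0 *: p ord0 + u) =
    (w ord0 / (w ord0 + s)) *: p ord0 + (1 - w ord0 / (w ord0 + s)) *: (s^-1 *: u).
  rewrite scalerDr !scalerA mulrC; congr (_ + _ *: _).
  by field; rewrite sn0 gt_eqF.
apply: cA => //; first by rewrite divr_ge0// ltW.
by rewrite ler_pdivrMr// mul1r lerDl.
Qed.

(** The missing weight [1 - \sum_i w i] goes to [x], which gives a barycenter of [n.+1] points. *)
Lemma convex_set_comb A x n (w : 'I_n -> R) (v : 'I_n -> V) :
  @convex_set R V A -> A x -> (forall i, A (x + v i)) ->
  (forall i, 0 <= w i) -> \sum_i w i <= 1 -> A (x + \sum_i w i *: v i).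
Proof.
move=> cA Ax Av w0 w1.
pose w' i := oapp w (1 - \sum_i w i) (unlift ord0 i).
pose p' i := oapp (fun j => x + v j) x (unlift ord0 i).
have sum1 : \sum_i w' i = 1.
  rewrite big_ord_recl /w' unlift_none /= [X in _ + X](eq_bigr w) ?subrK// => i _.
  by rewrite liftK.
have <- : \sum_i w' i *: p' i = x + \sum_i w i *: v i.
  rewrite big_ord_recl /w' /p' unlift_none /=.
  rewrite [X in _ + X](eq_bigr (fun i => w i *: x + w i *: v i)); last first.
    by move=> i _; rewrite liftK /= scalerDr.
  by rewrite big_split/= -scaler_suml addrA -scalerDl subrK scale1r.
have := @convex_set_sum A _ w' p' cA.
rewrite sum1 invr1 scale1r; apply=> [i|i|//].
  by rewrite /p'; case: unliftP => /=.
by rewrite /w'; case: unliftP => //= _; rewrite subr_ge0.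
Qed.

End Convexity.

Lemma continuous_sum {R : realType} {T : topologicalType} {V : normedModType R}
    I (r : seq I) (f : I -> T -> V) :
  (forall i, continuous (f i)) -> continuous (fun x => \sum_(i <- r) f i x).
Proof.
move=> cf x; elim: r => [|i r IH].
  by under eq_fun do rewrite big_nil; apply: cvg_cst.
under eq_fun do rewrite big_cons.
by apply: continuousD => //; apply: cf.
Qed.

Lemma continuous_coordZ {R : realType} n {V : normedModType R} (i : 'I_n) (c : V) :
  continuous (fun w : 'rV[R]_n => w 0 i *: c).
Proof.
move=> w; apply: (@cvgZr_tmp R V 'rV[R]_n (nbhs w) _ (fun w => w 0 i) (w 0 i) c).
exact: (@coord_continuous R 1 n ord0 i w).
Qed.

Section Polytopes.
Context {R : realType} {k : nat}.
Implicit Types (C D F : set 'rV[R]_k).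

Lemma polytope_convex C : polytope C -> @convex_set R 'rV[R]_k C.
Proof.
move=> [A _ ->]; apply/convex_setE => x y t t0 t1 Ax Ay B [cB AB].
by move/convex_setE : (cB); apply => //; [apply: Ax|apply: Ay].
Qed.

(** The hull of finitely many points is the image of the compact standard simplex [K] under the
    continuous barycenter map [f]. *)
Lemma polytope_closed C : polytope C -> closed C.
Proof.
move=> pC; have cC := polytope_convex pC; case: pC => A /finite_seqP[s ->{A}] CE.
have sC a : a \in s -> C a by rewrite CE => sa; apply: sub_gen_smallest.
pose f (w : 'rV[R]_(size s)) := \sum_(i < size s) w 0 i *: s`_i.
pose K := [set w : 'rV[R]_(size s) | forall i, `[0, 1]%classic (w ord0 i)] `&`
  (fun w : 'rV[R]_(size s) => \sum_(i < size s) w 0 i) @^-1` [set 1].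
have csum : continuous (fun w : 'rV[R]_(size s) => \sum_(i < size s) w 0 i).
  by apply: (@continuous_sum R _ R^o) => i; exact: coord_continuous.
have cK : compact K.
  apply: compact_closedI.
    by apply: (@rV_compact R _ (fun=> `[0, 1]%classic)) => _; apply: segment_compact.
  by apply: ((continuous_closedP _).1 csum); exact: closed_eq.
suff -> : C = f @` K.
  apply: (compact_closed (@norm_hausdorff R 'rV[R]_k)).
  apply: continuous_compact => //; apply: continuous_subspaceT.
  have cf : continuous f.
    apply: (@continuous_sum R _ 'rV[R]_k) => i; exact: continuous_coordZ.
  exact: cf.
apply/seteqP; split=> [|_ [w [w01 /= w1] <-]]; last first.
  have := @convex_set_sum _ _ C _ (fun i => w 0 i) (fun i => s`_i) cC.
  rewrite w1 invr1 scale1r; apply => // i.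
    by apply: sC; rewrite mem_nth.
  by have := w01 i; rewrite /= in_itv/= => /andP[].
rewrite CE; apply: smallest_sub.
  apply/convex_setE => _ _ t t0 t1 [w [w01 /= w1] <-] [v [v01 /= v1] <-].
  exists (t *: w + (1 - t) *: v).
    split=> [i|/=].
      have := w01 i; have := v01 i; rewrite /= !in_itv/= !mxE.
      by move=> /andP[? ?] /andP[? ?]; apply/andP; split; nra.
    under eq_bigr do rewrite !mxE.
    by rewrite big_split/= -!mulr_sumr w1 v1; ring.
  rewrite /f !scaler_sumr -big_split; apply: eq_bigr => i _ /=.
  by rewrite !mxE [LHS]scalerDl !scalerA.
move=> a /= sa; have ia : (index a s < size s)%N by rewrite index_mem.
exists (delta_mx 0 (Ordinal ia)).
  split=> [i|/=]; first by rewrite /= in_itv/= mxE eqxx ler0n lern1 leq_b1.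
  rewrite (bigD1 (Ordinal ia))//= mxE !eqxx big1 ?addr0// => i /negPf ni.
  by rewrite mxE ni andbF.
rewrite /f (bigD1 (Ordinal ia))//= mxE !eqxx scale1r nth_index// big1 ?addr0//.
by move=> i /negPf ni; rewrite mxE ni andbF scale0r.
Qed.

(** Take a finite list in [F] whose differences with [x] span a space of maximal dimension:
    adjoining another point of [F] cannot enlarge the span. *)
Lemma spanning_points F x : exists2 ps : seq 'rV[R]_k,
  (forall p, p \in ps -> F p) &
  forall p, F p -> p - x \in <<[seq q - x | q <- ps]>>%VS.
Proof.
pose P n := `[< exists2 ps : seq 'rV[R]_k, (forall p, p \in ps -> F p) &
  \dim <<[seq q - x | q <- ps]>> = n >].
have exP : exists n, P n.
  by exists (\dim <<[seq q - x | q <- [::] : seq 'rV[R]_k]>>%VS); apply/asboolP;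
    exists [::].
have leP n : P n -> (n <= \dim {: 'rV[R]_k})%N.
  by move=> /asboolP[ps _ <-]; apply/dimvS/subvf.
case: (ex_maxnP exP leP) => n /asboolP[ps psF dimn] nmax.
exists ps => // p Fp; set U := <<_>>%VS in dimn *.
have /nmax : P (\dim (<[p - x]> + U)).
  apply/asboolP; exists (p :: ps); last by rewrite /= span_cons.
  by move=> q; rewrite inE => /predU1P[->|/psF].
rewrite -dimn => le_dim; have : (U == <[p - x]> + U)%VS.
  by rewrite eqEdim addvSr.
by move=> /eqP->; rewrite memvE addvSl.
Qed.

Lemma convex_interior C :
  @convex_set R 'rV[R]_k C -> has_dim C k -> C° !=set0.
Proof.
move=> cC [[x Cx] [V [_ minV dimV]]].
have [ps psC span_ps] := spanning_points C x.
set X := [seq q - x | q <- ps] in span_ps.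
have XT : <<X>>%VS = fullv.
  apply/eqP; rewrite eqEdim subvf dimvf /dim/= mul1n -{1}dimV dimvS//.
  apply: minV => p q Cp Cq; have -> : p - q = (p - x) - (q - x).
    by rewrite opprB addrA subrK.
  by apply: rpredB; apply: span_ps.
pose n := size X; pose tX := in_tuple X.
(* The barycenter of x and the spanning points; a near z has coordinates g j a
   relative to z, too small to make a barycentric weight negative. *)
pose z : 'rV[R]_k := x + \sum_(j < n) n.+1%:R^-1 *: X`_j.
exists z.
pose g (j : 'I_n) (a : 'rV[R]_k) := coord tX j (a - z).
have cg j : continuous (g j).
  pose h (a : 'rV[R]_k) : R^o :=
    \sum_i (a 0 i *: (coord tX j (delta_mx 0 i) : R^o)).
  have ch : continuous h.
    by apply: (@continuous_sum R _ R^o) => i; exact: (@continuous_coordZ R k R^o).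
  have -> : g j = fun a => h a - coord tX j z.
    apply/funext => a; rewrite /g linearB/= {1}(row_sum_delta a) linear_sum/=.
    by congr (_ - _); apply: eq_bigr => i _; rewrite linearZ.
  move=> a; apply: (@cvgB R R^o _ (nbhs a) _ h (cst (coord tX j z))).
    exact: ch.
  exact: cvg_cst.
(* This bound keeps each weight [n.+1%:R^-1 + g j a] nonnegative and their sum at most
   [n (1/(n+1) + 1/(n+1)^2) = 1 - 1/(n+1)^2], which leaves a nonnegative weight for [x]. *)
have e0 : 0 < n.+1%:R^-2 :> R by rewrite invr_gt0 exprn_gt0.
have near_z (j : 'I_n) : nbhs z [set a | `|g j a| < n.+1%:R^-2].
  have /(@cvgr_dist_lt R R^o)/(_ _ e0) := cg j z.
  by apply: filterS => a; rewrite /g subrr linear0 sub0r normrN.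
change (nbhs z C); have Fz : Filter (nbhs z) by exact: nbhs_filter.
have := filter_forall Fz near_z; apply: filterS => a ga.
have gb j : - n.+1%:R^-2 < g j a < n.+1%:R^-2 by rewrite -ltr_norml; exact: ga.
have n1 : n.+1%:R != 0 :> R by rewrite pnatr_eq0.
have -> : a = x + \sum_(j < n) (n.+1%:R^-1 + g j a) *: X`_j.
  have /(coord_span (X := tX)) : a - z \in <<X>>%VS by rewrite XT memvf.
  move=> /(canRL (subrK _)) {1}->.
  rewrite addrC -addrA -big_split/=; congr (_ + _).
  by apply: eq_bigr => j _; rewrite scalerDl.
have le1 : n.+1%:R^-2 <= n.+1%:R^-1 :> R.
  by rewrite lef_pV2 ?posrE ?exprn_gt0// expr2 ler_peMl// ler1n.
apply: convex_set_comb => // [j|j|].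
- have : X`_j \in X by rewrite mem_nth.
  by move=> /mapP[q /psC Cq ->]; rewrite addrC subrK.
- move: (gb j) le1; move: (g j a) (n.+1%:R^-2) (n.+1%:R^-1) => t e u; lra.
- apply: (@le_trans _ _ (\sum_(j < n) (n.+1%:R^-1 + n.+1%:R^-2))).
    apply: ler_sum => j _; by rewrite lerD2l ltW//; have /andP[] := gb j.
  rewrite sumr_const card_ord -[leLHS]mulr_natl.
  have -> : n%:R = n.+1%:R - 1 :> R by rewrite -natr1 addrK.
  move: n1 e0; move: (n.+1%:R) => m m0 e0.
  rewrite [leLHS](_ : _ = 1 - m ^- 2); last by field.
  by rewrite gerBl ltW.
Qed.

(** Move [y] slightly towards an interior point [z]: by convexity, shrinking the ball around [z]
    towards [y] gives a ball in [C] around the moved point. *)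
Lemma convex_sub_closure_interior C :
  @convex_set R 'rV[R]_k C -> C° !=set0 -> C `<=` closure C°.
Proof.
move=> /convex_setE cC [z /nbhs_ballP[r /= r0 zr]] y Cy B /nbhs_ballP[e /= e0 yB].
(* The moved point is at distance [t * |y - z| < e] from [y]; the summand [e] keeps the denominator
   positive when [y = z]. *)
pose t := e / (e + `|y - z|).
have den0 : 0 < e + `|y - z| by rewrite ltr_pwDl.
have t0 : 0 < t by rewrite divr_gt0.
have t1 : t <= 1 by rewrite ler_pdivrMr// mul1r lerDl.
exists (t *: z + (1 - t) *: y); split.
  apply/nbhs_ballP; exists (t * r) => /=; first by rewrite mulr_gt0.
  move=> q; rewrite -ball_normE /= => qB.
  have -> : q = t *: (z + t^-1 *: (q - (t *: z + (1 - t) *: y))) + (1 - t) *: y.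
    by rewrite scalerDr scalerA divff ?gt_eqF// scale1r [RHS]addrAC [RHS]addrC subrK.
  apply: cC => //; first exact: ltW.
  apply: zr; rewrite -ball_normE /= opprD addrA subrr sub0r normrN normrZ.
  rewrite gtr0_norm ?invr_gt0// mulrC ltr_pdivrMr// mulrC.
  by rewrite distrC.
apply: yB; rewrite -ball_normE /=.
have -> : y - (t *: z + (1 - t) *: y) = t *: (y - z).
  by rewrite scalerBl scale1r scalerBr addrCA opprD addrA subrr sub0r opprB.
rewrite normrZ gtr0_norm// /t mulrAC ltr_pdivrMr// ltr_pM2l//.
by rewrite ltrDr.
Qed.

(** This property survives scaling and replaces convexity in the lemmas on families of cells. *)
Lemma cell_regular_closed C :
  polytope C -> has_dim C k -> closure C° = C.
Proof.
move=> pC dC; have cC := polytope_convex pC; apply/seteqP; split.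
  rewrite [X in _ `<=` X]((closure_id C).1 (polytope_closed pC)).
  by apply: closureS; apply: interior_subset.
exact/convex_sub_closure_interior/convex_interior.
Qed.

End Polytopes.

(** * Families of cells *)

Section Families.
Context {R : realType} {k : nat}.
Implicit Types (C D E : set 'rV[R]_k) (S : set (set 'rV[R]_k)).

(** Makes the indicator of [E] vanish on all of [D°], including at boundary points of [E]. *)
Lemma interior_disjoint_regular_closed (X : topologicalType) (D E : set X) :
  closure E° = E -> D° `&` E° = set0 -> D° `&` E = set0.
Proof.
move=> rE DE0; apply/seteqP; split=> // x [Dx].
rewrite -rE => /(_ _ (nbhs_interior Dx))[y [Ey Dy]].
by have : (D° `&` E°) y by []; rewrite DE0.
Qed.

Lemma sub_cell S (c : set 'rV[R]_k -> R) C D :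
  (forall E, S E -> closure E° = E) ->
  (forall D E, S D -> S E -> D <> E -> D° `&` E° = set0) ->
  closed C -> eq_ae (\1_C) (indicator_combination S c) ->
  S D -> (D° `&` C°) !=set0 -> D `<=` C.
Proof.
move=> regS disS clC /interior_lebesgue_null null SD [z [Dz Cz]].
have sumD x : D° x -> indicator_combination S c x = c D.
  move=> Dx; rewrite /indicator_combination -(fsbig_widen [set D])/=.
  - rewrite fsbig_set1 indicE mem_set ?mulr1//; exact: interior_subset.
  - by move=> E ->.
  - move=> E [SE /= nED]; rewrite indicE memNset ?mulr0// => Ex.
    have := interior_disjoint_regular_closed (regS _ SE) (disS _ _ SD SE (nesym nED)).
    by move=> /seteqP[/(_ x)] + _; apply.
(* The exceptional null set has empty interior, so the two functions agree somewhere in every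
   nonempty open set. *)
have meets O : open O -> O !=set0 -> exists2 x, O x & \1_C x = indicator_combination S c x.
  move=> oO [y Oy]; apply: contrapT => nex.
  suff : ([set x | \1_C x <> indicator_combination S c x])° y by rewrite null.
  rewrite /interior/=; apply: filterS (open_nbhs_nbhs (conj oO Oy)) => x Ox eqx.
  by apply: nex; exists x.
have [x [Dx Cx]] := meets _ (openI (open_interior D) (open_interior C))
  (ex_intro _ z (conj Dz Cz)).
rewrite sumD// indicE mem_set => [cD|]; last exact: interior_subset.
(* It suffices that [D°] lies in [C]; otherwise the open set [D° \ C] contains a point where the
   value 0 of the indicator equals [c D = 1]. *)
rewrite -(regS _ SD) ((closure_id C).1 clC); apply: closureS => y Dy.
apply: contrapT => nCy.
have [u [Du nCu]] := meets _ (openI (open_interior D) (closed_openC clC))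
  (ex_intro _ y (conj Dy nCy)).
rewrite sumD// -cD indicE memNset// => /eqP; by rewrite eq_sym oner_eq0.
Qed.

(** Near [x] only finitely many members of [S'] matter, and a finite union of closed sets is
    closed. *)
Lemma locally_finite_closure S S' x : locally_finite S -> S' `<=` S ->
  (forall D, S D -> closed D) ->
  closure (\bigcup_(D in S') D) x -> exists2 D, S' D & D x.
Proof.
move=> lfS S'S clS clx; have [U xU finU] := lfS x.
pose N := [set D | S' D /\ (D `&` U) !=set0].
have finN : finite_set N by apply: sub_finite_set finU => D [/S'S].
have clN : closed (\bigcup_(D in N) D).
  by apply: closed_bigcup => // D [/S'S/clS].
have [D [S'D _] Dx] : (\bigcup_(D in N) D) x.
  apply: clN => B xB.
  have [y [[D S'D Dy] [By Uy]]] := clx _ (filterI xB xU).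
  by exists y; split=> //; exists D => //; split=> //; exists y.
by exists D.
Qed.

(** A point of [C°] near [y] lies in some [D] of [S], possibly on its boundary; regularity gives a
    nearby point of [D°] still in [C°], so [D] lies in [C]. Hence [y] is in the closure of the union
    of such [D]. *)
Lemma cells_cover_cell S C y : locally_finite S ->
  (forall D, S D -> closure D° = D) -> \bigcup_(D in S) D = setT ->
  closure C° = C -> (forall D, S D -> (D° `&` C°) !=set0 -> D `<=` C) ->
  C y -> exists2 D, S D /\ D `<=` C & D y.
Proof.
move=> lfS regS covS regC subC Cy.
apply: (@locally_finite_closure S [set D | S D /\ D `<=` C]) => //.
- by move=> D [].
- by move=> D /regS <-; apply: closed_closure.
have clCy : closure C° y by rewrite regC.
move=> B yB; have [p [Cp Bp]] := clCy _ (nbhs_interior yB).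
have : (\bigcup_(D in S) D) p by rewrite covS.
move=> [D SD]; rewrite -{1}(regS _ SD).
move=> /(_ _ (filterI (nbhs_interior Cp) (nbhs_interior Bp)))[q [Dq [Cq Bq]]].
exists q; split; last exact: interior_subset.
exists D; last exact: interior_subset.
by split=> //; exact: (subC D SD (ex_intro _ q (conj Dq Cq))).
Qed.

End Families.

(** * Curves in a convex set *)

Section Curve.
Context {R : realType} {k : nat}.
Implicit Types (x p : 'rV[R]_k) (ps : seq 'rV[R]_k) (F : set 'rV[R]_k).

(* Iterated barycenter, in which p_i gets weight t (1 - t)^i: convexity is used
   for two points at a time, and evaluating at t = 0 and t = 1 peels off the
   coefficients of the polynomial one by one. *)
Definition curve x ps (t : R) : 'rV[R]_k :=
  foldr (fun p z => t *: p + (1 - t) *: z) x ps.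

Lemma curve0 x ps : curve x ps 0 = x.
Proof.
by elim: ps => //= p ps IH; rewrite scale0r add0r subr0 scale1r.
Qed.

Lemma curve_convex F x ps t : @convex_set R 'rV[R]_k F -> F x ->
  (forall p, p \in ps -> F p) -> 0 <= t -> t <= 1 -> F (curve x ps t).
Proof.
move=> /convex_setE cF Fx + t0 t1; elim: ps => //= p ps IH psF.
apply: cF => //; first by apply: psF; rewrite mem_head.
by apply: IH => q qps; apply: psF; rewrite inE qps orbT.
Qed.

Lemma continuous_curve x ps : continuous (curve x ps).
Proof.
elim: ps => [|p ps IH] t; first exact: cvg_cst.
apply: cvgD.
  apply: (@cvgZr_tmp R 'rV[R]_k R (nbhs t) _ id t p); exact: cvg_id.
apply: (@cvgZ R 'rV[R]_k R (nbhs t) _ (fun t => 1 - t) (curve x ps) (1 - t)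
  (curve x ps t)) => //.
  by apply: cvgB; [exact: cvg_cst|exact: cvg_id].
exact: IH.
Qed.

Lemma curve_poly (phi : {linear 'rV[R]_k -> R^o}) x ps :
  exists2 q : {poly R}, forall t, q.[t] = phi (curve x ps t - x) &
    q = 0 -> forall p, p \in ps -> phi (p - x) = 0.
Proof.
elim: ps => [|p ps [q qE q0]].
  by exists 0 => [t|//]; rewrite /= subrr linear0 horner0.
exists ((phi (p - x))%:P * 'X + (1 - 'X) * q) => [t|].
  rewrite !hornerE /= qE.
  have -> : t *: p + (1 - t) *: curve x ps t - x =
      t *: (p - x) + (1 - t) *: (curve x ps t - x).
    rewrite !scalerBr addrACA -opprD; congr (_ - _).
    by rewrite -scalerDl addrCA subrr addr0 scale1r.
  by rewrite [RHS]linearD [in RHS]linearZ [X in _ = _ + X]linearZ /= mulrC.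
move=> qp; have p0 : phi (p - x) = 0.
  by have := congr1 (horner^~ 1) qp; rewrite !hornerE subrr mul0r addr0.
(* The factor [1 - 'X] has value 1 at 0, hence is nonzero and can be cancelled. *)
move: qp; rewrite p0 mul0r add0r => /eqP; rewrite mulf_eq0 => /orP[|/eqP/q0 qps].
  move=> /eqP/(congr1 (horner^~ 0)); rewrite !hornerE subr0 => /eqP.
  by rewrite oner_eq0.
by move=> r; rewrite inE => /predU1P[->|/qps].
Qed.

(** A polynomial equal to [c] at infinitely many parameters is constant; this one is 0 at 0, where
    the curve is at [x], so it is the zero polynomial. *)
Lemma curve_const (phi : {linear 'rV[R]_k -> R^o}) x ps (A : set R) (c : R) :
  infinite_set A -> (forall t, A t -> phi (curve x ps t - x) = c) ->
  forall p, p \in ps -> phi (p - x) = 0.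
Proof.
move=> infA Ac; have [q qE q0] := curve_poly phi x ps; apply: q0.
have qc : q = c%:P.
  apply/eqP; rewrite -subr_eq0; apply: contraT => qc0.
  have [B BA leB] := infinite_set_fset (size (q - c%:P)) infA.
  have rB : all (root (q - c%:P)) (finmap.enum_fset B).
    by apply/allP => t tB; rewrite rootE !hornerE qE Ac ?subrr//; apply: BA.
  by have := max_poly_roots qc0 rB (finmap.fset_uniq B); rewrite ltnNge leB.
have := qE 0; rewrite curve0 subrr linear0 qc hornerC => ->.
by rewrite polyC0.
Qed.

(** Meant for the finitely many cells near [x]: since [U] is arbitrary, pieces of [F] whose
    direction contains [V] are found arbitrarily close to [x]. *)
Lemma spans_differences_dense F (V : {vspace 'rV[R]_k}) x
    (N : set (set 'rV[R]_k)) (U : set 'rV[R]_k) :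
  @convex_set R 'rV[R]_k F -> F x ->
  (forall W : {vspace 'rV[R]_k}, spans_differences F W -> (V <= W)%VS) ->
  finite_set N -> nbhs x U -> F `&` U `<=` \bigcup_(E in N) E ->
  exists2 E, N E & (E `&` U) !=set0 /\
    forall W : {vspace 'rV[R]_k}, spans_differences (E `&` F) W -> (V <= W)%VS.
Proof.
move=> cF Fx minV finN xU cov; apply: contrapT => nex.
(* If [E] meets [U], the point [p] witnesses that the trace of [E] on [F] is too small; the default
   [x] for the other sets makes [choice] applicable. *)
have escape E : exists p, F p /\ (N E -> (E `&` U) !=set0 ->
    exists2 W : {vspace 'rV[R]_k}, spans_differences (E `&` F) W & p - x \notin W).
  have [NE|nNE] := pselect (N E); last by exists x.
  have [EU|nEU] := pselect ((E `&` U) !=set0); last by exists x.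
  have [W EW nVW] : exists2 W : {vspace 'rV[R]_k},
      spans_differences (E `&` F) W & ~ (V <= W)%VS.
    apply: contrapT => nW; apply: nex; exists E => //; split=> // W EW.
    by apply: contrapT => nVW; apply: nW; exists W.
  have [p Fp pW] : exists2 p, F p & p - x \notin W.
    apply: contrapT => nopt; apply/nVW/minV => y z Fy Fz.
    have -> : y - z = (y - x) - (z - x) by rewrite opprB addrA subrK.
    have inW p : F p -> p - x \in W.
      by move=> Fp; apply: contrapT => /negP pW; apply: nopt; exists p.
    by apply: rpredB; apply: inW.
  by exists p; split=> // _ _; exists W.
have [f fP] := choice escape.
have /finite_seqP[s Ns] := finN.
pose y := curve x (map f s).
have /nbhs_ballP[d /= d0 dU] : nbhs (0 : R) (y @^-1` U).
  by apply: continuous_curve; rewrite curve0.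
(* Distinct positive parameters; [n.+2] keeps them strictly below [d], so that [y (g n)] is in [U],
   and below 1, so that it is in [F]. *)
pose g (n : nat) : R := Num.min d 1 / n.+2%:R.
have m0 : 0 < Num.min d 1 by rewrite lt_min d0 ltr01.
have g0 n : 0 < g n by rewrite divr_gt0.
have g_inj : injective g.
  move=> m n /mulfI; rewrite gt_eqF// => /(_ isT)/invr_inj/eqP.
  by rewrite eqr_nat => /eqP[].
have gm n : g n < Num.min d 1.
  by rewrite ltr_pdivrMr// ltr_pMr// ltr1n.
have gU n : U (y (g n)).
  apply: dU; rewrite -ball_normE /= sub0r normrN gtr0_norm//.
  by apply: lt_le_trans (gm n) _; rewrite ge_min lexx.
have gF n : F (y (g n)).
  apply: curve_convex => //; [|exact: ltW|].
    by move=> p /mapP[E _ ->]; have [] := fP E.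
  by apply: le_trans (ltW (gm n)) _; rewrite ge_min lexx orbT.
(* Infinitely many of these curve points in [E] would force [f E - x] into [W], against the choice
   of [f E]. *)
have finE E : N E -> finite_set [set n | E (y (g n))].
  move=> NE; apply: contrapT => infE.
  have [n0 /= En0] := infinite_setN0 infE.
  have [_ /(_ NE)[|W EW]] := fP E; first by exists (y (g n0)).
  apply/negP; rewrite negbK.
  suff fix_p : f E - x - projv W (f E - x) = 0.
    by move/subr0_eq : fix_p => ->; exact: memv_proj.
  apply/rowP => i; rewrite [RHS]mxE.
  (* A coordinate of the projection along W: a linear form vanishing on W. *)
  pose phi (v : 'rV[R]_k) : R^o := (v - projv W v) 0 i.
  have phi_lin : linear phi.
    by move=> a u v; rewrite /phi linearP !mxE opprD addrACA -mulrBr.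
  pose phiL := HB.pack phi (GRing.isLinear.Build _ _ _ _ phi phi_lin)
    : {linear 'rV[R]_k -> R^o}.
  change (phiL (f E - x) = 0).
  apply: (@curve_const phiL x (map f s) [set g n | n in [set n | E (y (g n))]]
    (phi (y (g n0) - x))).
  - move=> fin; apply: infE.
    by apply: sub_finite_set (finite_preimage (in2W g_inj) fin) => n En; exists n.
  - move=> _ [n /= En <-]; apply/eqP; rewrite -subr_eq0.
    have -> : phi (y (g n) - x) - phi (y (g n0) - x) = phi (y (g n) - y (g n0)).
      by rewrite -(linearB phiL)/= opprB addrA subrK.
    by rewrite /phi projv_id ?subrr ?mxE//; apply: EW.
  - by apply: map_f; move: NE; rewrite Ns.
(* Every [y (g n)] lies in some [E] of [N], so the natural numbers would be a finite union of finite
   sets. *)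
apply: infinite_nat; apply: sub_finite_set (bigcup_finite finN finE) => n _.
by have [E NE Ey] := cov _ (conj (gF n) (gU n)); exists E.
Qed.

End Curve.

(** * Scaling *)

Section Scaling.
Context {R : realType} {V : normedModType R}.
Implicit Types (A : set V).

Lemma image_scale (l : R) A : l != 0 ->
  [set l *: x | x in A] = ( *:%R l^-1) @^-1` A.
Proof.
move=> l0; apply/seteqP; split=> [_ [x Ax <-] /=|x /= Ax].
  by rewrite scalerA mulVf// scale1r.
by exists (l^-1 *: x) => //; rewrite scalerA divff// scale1r.
Qed.

Lemma nbhs_scale (l : R) A x : l != 0 ->
  nbhs x (( *:%R l) @^-1` A) <-> nbhs (l *: x) A.
Proof.
have cont (m : R) (y : V) B : nbhs (m *: y) B -> nbhs y (( *:%R m) @^-1` B).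
  exact: (@scaler_continuous R V m y B).
move=> l0; split; last exact: cont.
move=> nA; have /cont : nbhs (l^-1 *: (l *: x)) (( *:%R l) @^-1` A).
  by rewrite scalerA mulVf// scale1r.
by apply: filterS => y /=; rewrite scalerA divff// scale1r.
Qed.

Lemma interior_scale (l : R) A : l != 0 ->
  [set l *: x | x in A]° = [set l *: x | x in A°].
Proof.
move=> l0; rewrite !image_scale//; apply/seteqP; split=> x.
  by move/(nbhs_scale _ _ (invr_neq0 l0)).
by move=> ?; apply/(nbhs_scale _ _ (invr_neq0 l0)).
Qed.

Lemma closure_scale (l : R) A : l != 0 ->
  closure [set l *: x | x in A] = [set l *: x | x in closure A].
Proof.
move=> l0; rewrite -[LHS]setCK -interiorC image_scale// preimage_setC.
by rewrite -image_scale// interior_scale// interiorC !image_scale// preimage_setC setCK.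
Qed.

End Scaling.

Section ScaledTessellation.
Context {R : realType} {k : nat} (T : set (set 'rV[R]_k)) (l : R) (l0 : l != 0).

Lemma scale_locally_finite : locally_finite T -> locally_finite (scale_family l T).
Proof.
move=> lfT x; have [U xU finU] := lfT (l^-1 *: x).
exists (( *:%R l^-1) @^-1` U); first exact/nbhs_scale/xU/invr_neq0.
apply: sub_finite_set (finite_image (fun C => [set l *: x | x in C]) finU).
move=> _ [[C TC <-] [_ [[y Cy <-] /=]]].
rewrite scalerA mulVf// scale1r => Uy.
by exists C => //; split=> //; exists y.
Qed.

Lemma scale_cover :
  \bigcup_(C in T) C = setT -> \bigcup_(D in scale_family l T) D = setT.
Proof.
move=> covT; apply/seteqP; split=> // x _.
have [C TC Cx] : (\bigcup_(C in T) C) (l^-1 *: x) by rewrite covT.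
exists [set l *: x | x in C]; first by exists C.
by rewrite image_scale.
Qed.

Lemma scale_regular_closed :
  (forall C, T C -> closure C° = C) ->
  forall D, scale_family l T D -> closure D° = D.
Proof.
by move=> regT _ [C TC <-]; rewrite interior_scale// closure_scale// regT.
Qed.

Lemma scale_interior_disjoint :
  (forall C D, T C -> T D -> C <> D -> C° `&` D° = set0) ->
  forall C D, scale_family l T C -> scale_family l T D -> C <> D ->
    C° `&` D° = set0.
Proof.
move=> disT _ _ [C TC <-] [D TD <-] nCD; rewrite !interior_scale// !image_scale//.
rewrite -preimage_setI disT ?preimage_set0// => CD; by apply: nCD; rewrite CD.
Qed.

End ScaledTessellation.

(** * Facets of a refinable tessellation *)

Theorem proposition1 (R : realType) (k : nat) (T : set (set 'rV[R]_k))
    (lambda : R) :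
  tessellation T -> 0 < lambda -> lambda < 1 -> refinable lambda T ->
  forall F : set 'rV[R]_k, facet T F ->
    exists2 G : set (set 'rV[R]_k),
      G `<=` facet (scale_family lambda T) & F = \bigcup_(f in G) f.
Proof.
move=> [lfT cellT covT disT] lambda_gt0 _ refT F [C TC [[u [b [uC FE]]]]].
move=> [d dk [_ [V [FV minV dimV]]]].
have l0 : lambda != 0 by rewrite gt_eqF.
have regT D : T D -> closure D° = D.
  by move=> /cellT[]; apply: cell_regular_closed.
set S := scale_family lambda T.
have regS := scale_regular_closed l0 regT.
have lfS := scale_locally_finite l0 lfT.
have clS D : S D -> closed D by move=> /regS <-; apply: closed_closure.
have [pC _] := cellT _ TC.
have subC D : S D -> (D° `&` C°) !=set0 -> D `<=` C.
  have [c ae_c] := refT _ TC.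
  apply: (sub_cell regS (scale_interior_disjoint l0 disT) _ ae_c).
  exact: polytope_closed.
have covC y : C y -> exists2 D, S D /\ D `<=` C & D y.
  exact: (cells_cover_cell lfS regS (scale_cover l0 covT) (regT _ TC) subC).
have cF : @convex_set R 'rV[R]_k F.
  have /convex_setE cC := polytope_convex pC.
  apply/convex_setE => x y t t0 t1; rewrite FE => -[Cx /= xb] [Cy /= yb].
  split; first exact: cC.
  rewrite /= mulmxDl -!scalemxAl mxE [X in X + _]mxE [X in _ + X]mxE xb yb.
  by rewrite -mulrDl subrKC mul1r.
(* The last clause says that the trace of [D] on [F] is not of smaller dimension than [F]. *)
pose good D := [/\ S D, D `<=` C &
  forall W : {vspace 'rV[R]_k}, spans_differences (D `&` F) W -> (V <= W)%VS].
exists [set D `&` F | D in [set D | good D /\ (D `&` F) !=set0]].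
  move=> _ [D [[SD DC minW] DF0] <-]; exists D => //; split.
    (* The inequality cutting [F] out of [C] remains valid on [D], which lies in [C]. *)
    exists u, b; split; first by move=> x /DC; apply: uC.
    by rewrite FE setIA (setIidl DC).
  exists d => //; split=> //; exists V; split=> // x y [_ Fx] [_ Fy].
  exact: FV.
apply/seteqP; split=> [x Fx|x [_ [D _ <-] []//]].
have [U xU finU] := lfS x.
suff [D gD Dx] : exists2 D, good D & D x.
  by exists (D `&` F) => //; exists D => //; split=> //; exists x.
(* It now suffices that good cells meet every neighborhood [B] of [x]. *)
apply: (locally_finite_closure lfS _ clS) => [D []//|B xB].
pose N := [set D | (S D /\ (D `&` U) !=set0) /\ D `<=` C].
have finN : finite_set N by apply: sub_finite_set finU => D [].
have covN : F `&` (B `&` U) `<=` \bigcup_(D in N) D.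
  move=> y [Fy [_ Uy]]; have Cy : C y by move: Fy; rewrite FE => -[].
  have [D [SD DC] Dy] := covC _ Cy.
  by exists D => //; split=> //; split=> //; exists y.
have [D [[SD _] DC] [[y [Dy [By _]]] minW]] :=
  spans_differences_dense cF Fx minV finN (filterI xB xU) covN.
by exists y; split=> //; exists D.
Qed.
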